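(* Let $A\in\mathbb{M}_n(\mathbb{C})$ and $B\in\mathbb{M}_m(\mathbb{C})$. Then the direct sum $A\oplus B=\begin{bmatrix}A&0\\0&B\end{bmatrix}\in\mathbb{M}_{n+m}(\mathbb{C})$ is CEPD if and only if both $A$ and $B$ are CEPD.
   Context: $\mathbb{M}_n(\mathbb{C})$ is the algebra of $n\times n$ complex matrices; $^*$ is conjugate transpose; $\mathcal{R}(\cdot)$ is column space; $A^0=I$. The index $\mathrm{ind}(A)$ is the smallest integer $k\ge 0$ with $\mathrm{rank}(A^k)=\mathrm{rank}(A^{k+1})$. With $k=\mathrm{ind}(A)$, the Drazin inverse $A^D$ is the unique $X$ with $AX=XA$, $XAX=X$, $XA^{k+1}=A^k$. The core EP inverse of $A$, denoted here $A^{\mathrm{cep}}$, is the unique square $X$ with $XAX=X$ and $\mathcal{R}(X)=\mathcal{R}(A^k)=\mathcal{R}(X^* )$. A square matrix $A$ is called core EP Drazin (CEPD) if $A^{\mathrm{cep}}A^D=A^DA^{\mathrm{cep}}$. *)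

(* Defs.v *)
From HB Require Import structures.
From mathcomp Require Import all_boot all_order all_algebra.
From mathcomp Require Import reals complex.

Set Implicit Arguments.
Unset Strict Implicit.
Unset Printing Implicit Defensive.

Import Order.TTheory GRing.Theory Num.Theory.
Local Open Scope ring_scope.

Section Drazin.
Variables (F : fieldType) (n : nat).
Implicit Types A X Y : 'M[F]_n.

Lemma expmxS A k : A ^+ k.+1 = A *m A ^+ k. Proof. exact: exprS. Qed.
Lemma expmxSr A k : A ^+ k.+1 = A ^+ k *m A. Proof. exact: exprSr. Qed.
Lemma expmxD A j k : A ^+ (j + k) = A ^+ j *m A ^+ k. Proof. exact: exprD. Qed.

Lemma mindex_exists A : exists k, \rank (A ^+ k) == \rank (A ^+ k.+1).
Proof.
have [k Pk|noP] :=
  pickP (fun k : 'I_n.+1 => \rank (A ^+ k) == \rank (A ^+ k.+1)).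
  by exists k.
suff H k : (k <= n.+1)%N -> (\rank (A ^+ k) + k <= n)%N.
  by have := leq_trans (leq_addl _ _) (H _ (leqnn _)); rewrite ltnn.
elim: k => [|k IHk] lekn; first by rewrite addn0 rank_leq_row.
apply: leq_trans (IHk (ltnW lekn)); rewrite addnS ltn_add2r.
rewrite ltn_neqAle eq_sym; have /= -> := noP (Ordinal lekn).
by rewrite expmxS mxrankM_maxr.
Qed.

Definition mindex A : nat := ex_minn (mindex_exists A).

Lemma mindexP A : \rank (A ^+ mindex A) = \rank (A ^+ (mindex A).+1).
Proof. by rewrite /mindex; case: ex_minnP => k /eqP. Qed.

Lemma mindex_min A k : \rank (A ^+ k) = \rank (A ^+ k.+1) -> (mindex A <= k)%N.
Proof. by move=> /eqP rk; rewrite /mindex; case: ex_minnP => j _; apply. Qed.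

Lemma mindex_row A j : exists Y, A ^+ mindex A = Y *m A ^+ (mindex A + j).
Proof.
set k := mindex A.
have sub1 : (A ^+ k <= A ^+ k.+1)%MS.
  suff /eqmxP -> : (A ^+ k.+1 == A ^+ k)%MS by [].
  by rewrite -mxrank_leqif_eq -?mindexP // expmxS submxMl.
have [D defD] := submxP sub1.
elim: j => [|j [Y defY]]; first by exists 1%:M; rewrite addn0 mul1mx.
by exists (Y *m D); rewrite {1}defY addnS -addSn !expmxD {1}defD !mulmxA.
Qed.

Lemma mindex_col A j : exists Z, A ^+ mindex A = A ^+ (mindex A + j) *m Z.
Proof.
set k := mindex A.
have sub1 : ((A ^+ k)^T <= (A ^+ k.+1)^T)%MS.
  suff /eqmxP -> : ((A ^+ k.+1)^T == (A ^+ k)^T)%MS by [].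
  by rewrite -mxrank_leqif_eq ?mxrank_tr -?mindexP // expmxSr trmx_mul submxMl.
have [D /(congr1 trmx)] := submxP sub1; rewrite trmx_mul !trmxK => defD.
elim: j => [|j [Z defZ]]; first by exists 1%:M; rewrite addn0 mulmx1.
exists (D^T *m Z); rewrite {1}defZ addnS -addSn ![(_ + j)%N]addnC !expmxD.
by rewrite {1}defD !mulmxA.
Qed.

Definition is_drazin A X : bool :=
  [&& A *m X == X *m A, X *m A *m X == X
    & X *m A ^+ (mindex A).+1 == A ^+ mindex A].

Lemma drazin_exists A : exists X, is_drazin A X.
Proof.
have [Y defY] := mindex_row A (mindex A).+1.
have [Z defZ] := mindex_col A (mindex A).+1.
rewrite /is_drazin; move: (mindex A) defY defZ => k defY defZ.
have defX : Y *m A ^+ k = A ^+ k *m Z by rewrite {1}defZ mulmxA -defY.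
have XAk : Y *m A ^+ k *m A ^+ k.+1 = A ^+ k by rewrite -mulmxA -expmxD -defY.
have XA : Y *m A ^+ k *m A = Y *m A ^+ k.+1 by rewrite -mulmxA -expmxSr.
have AX : A *m (Y *m A ^+ k) = Y *m A ^+ k.+1.
  have -> : A ^+ k.+1 = A ^+ (k + k.+1) *m (A *m Z).
    by rewrite expmxS {1}defZ !mulmxA -expmxS -expmxSr.
  by rewrite defX 2!mulmxA -defY mulmxA -expmxS -expmxSr.
exists (Y *m A ^+ k); rewrite XAk AX XA !eqxx andbT /=.
by rewrite {1}defX mulmxA -(mulmxA Y) -expmxD addSnnS -defY -defX.
Qed.

Lemma drazin_colspace A X :
  is_drazin A X -> exists T, X = A ^+ mindex A *m T.
Proof.
case/and3P=> /eqP cX /eqP iX _.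
have powX j : exists T, X = A ^+ j *m T.
  elim: j => [|j [T defT]]; first by exists X; rewrite mul1mx.
  by exists (T *m X); rewrite expmxS -mulmxA (mulmxA _ T) -defT mulmxA cX iX.
exact: powX.
Qed.

Lemma drazin_unique A X Y : is_drazin A X -> is_drazin A Y -> X = Y.
Proof.
have aux U V : is_drazin A U -> is_drazin A V ->
    U *m A = V *m A *m (U *m A) /\ U *m A = U *m A *m (V *m A).
  move=> /and3P[/eqP cU /eqP iU _] /and3P[/eqP cV _ /eqP dV].
  have idU : (U *m A) *m (U *m A) = U *m A by rewrite mulmxA iU.
  have powU j : (U *m A) ^+ j.+1 = U *m A.
    by elim: j => [|j IHj]; rewrite ?expr1 // expmxS IHj idU.
  set k := (mindex A).+1.
  have UAl : U *m A = A ^+ k *m U ^+ k.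
    by rewrite -(powU (mindex A)) -cU; apply: exprMn_comm.
  have UAr : U *m A = U ^+ k *m A ^+ k.
    by rewrite -(powU (mindex A)); apply: exprMn_comm; apply/esym.
  have VAk : V *m A *m A ^+ k = A ^+ k.
    by rewrite -mulmxA -expmxS expmxSr mulmxA dV -expmxSr.
  have AkV : A ^+ k *m (V *m A) = A ^+ k.
    rewrite -cV mulmxA -expmxSr.
    have : GRing.comm V (A ^+ k.+1) by apply: commrX; apply/esym.
    by rewrite /GRing.comm -mulmxE => <-; rewrite expmxSr mulmxA dV -expmxSr.
  by split; [rewrite {2}UAl mulmxA VAk | rewrite {2}UAr -mulmxA AkV].
move=> dX dY; have [_ XYX] := aux X Y dX dY; have [YXY _] := aux Y X dY dX.
have XA_YA : X *m A = Y *m A by rewrite XYX -YXY.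
case/and3P: dX => /eqP cX /eqP iX _; case/and3P: dY => /eqP cY /eqP iY _.
by rewrite -iX XA_YA -mulmxA cX XA_YA mulmxA -[RHS]iY -!mulmxA cY.
Qed.

Definition drazin A : 'M[F]_n := xchoose (drazin_exists A).

Lemma drazinP A : is_drazin A (drazin A).
Proof. exact: xchooseP. Qed.

End Drazin.

Section CoreEP.
Variables (C : numClosedFieldType).

Definition ctrmx m n (M : 'M[C]_(m, n)) : 'M[C]_(n, m) := map_mx Num.conj M^T.

(* (_ == _)%MS compares row spaces, hence the transposes. *)
Definition eq_colspace m n p (M : 'M[C]_(m, n)) (N : 'M[C]_(m, p)) : bool :=
  (M^T == N^T)%MS.

Definition is_core_ep n (A X : 'M[C]_n) : bool :=
  [&& X *m A *m X == X, eq_colspace X (A ^+ mindex A)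
    & eq_colspace (A ^+ mindex A) (ctrmx X)].

Lemma ctrmxK m n : cancel (@ctrmx m n) (@ctrmx n m).
Proof. by move=> M; apply/matrixP => i j; rewrite !mxE conjCK. Qed.

Lemma ctrmx_mul m n p (M : 'M[C]_(m, n)) (N : 'M_(n, p)) :
  ctrmx (M *m N) = ctrmx N *m ctrmx M.
Proof. by rewrite /ctrmx trmx_mul map_mxM. Qed.

Lemma eq_colspaceP m n p (M : 'M[C]_(m, n)) (N : 'M_(m, p)) :
  reflect ((exists D, M = N *m D) /\ (exists E, N = M *m E)) (eq_colspace M N).
Proof.
apply: (iffP andP) => [[/submxP[D dM] /submxP[E dN]] | [[D ->] [E dN]]].
  split; [exists D^T | exists E^T]; apply: trmx_inj;
  by rewrite trmx_mul trmxK.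
split; first by rewrite trmx_mul submxMl.
by apply/submxP; exists E^T; rewrite -trmx_mul -dN.
Qed.

Lemma ctrmx_mul_eq0 m n (M : 'M[C]_(m, n)) : M *m ctrmx M = 0 -> M = 0.
Proof.
move=> MM; apply/matrixP => i j; rewrite mxE.
have /eqP := congr1 (fun N : 'M_m => N i i) MM; rewrite !mxE.
rewrite psumr_eq0 => [/allP/(_ j)|l _]; last by rewrite !mxE mul_conjC_ge0.
by rewrite mem_index_enum => /(_ isT); rewrite !mxE mul_conjC_eq0 => /eqP.
Qed.

Lemma colspace_projector m n (M : 'M[C]_(m, n)) :
  exists P : 'M[C]_m,
    [/\ ctrmx P = P, P *m M = M & exists S, P = M *m S].
Proof.
pose N := row_base (ctrmx M); have freeN : row_free N by apply: row_base_free.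
have /submxP[D dM] : (ctrmx M <= N)%MS by rewrite eq_row_base.
have /submxP[E dN] : (N <= ctrmx M)%MS by rewrite eq_row_base.
move: (\rank _) N => r N in freeN D dM E dN *.
have uN : N *m ctrmx N \in unitmx.
  rewrite -row_free_unit -kermx_eq0; apply/eqP/row_matrixP => i.
  set v := row i _; rewrite row0.
  have : v *m (N *m ctrmx N) = 0 by apply/sub_kermxP; rewrite row_sub.
  move/(congr1 (mulmx^~ (ctrmx v))) => /=.
  rewrite mul0mx -!mulmxA -ctrmx_mul mulmxA.
  by move/ctrmx_mul_eq0/eqP; rewrite mulmx_free_eq0 // => /eqP.
set G := N *m ctrmx N in uN; pose P := ctrmx N *m invmx G *m N.
have GH : ctrmx G = G by rewrite /G ctrmx_mul ctrmxK.
have PH : ctrmx P = P.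
  rewrite /P !ctrmx_mul ctrmxK !mulmxA; congr (_ *m _ *m _).
  by rewrite /ctrmx trmx_inv map_invmx -/(ctrmx G) GH.
exists P; split=> //.
  apply: (can_inj (@ctrmxK _ _)); rewrite ctrmx_mul PH dM /P !mulmxA.
  by rewrite -(mulmxA D) -/G mulmxK.
exists (ctrmx (ctrmx N *m invmx G *m E)).
by rewrite -[M in RHS]ctrmxK -ctrmx_mul -mulmxA -dN PH.
Qed.

Lemma core_ep_exists n (A : 'M[C]_n) : exists X, is_core_ep A X.
Proof.
have [X] := drazin_exists A; case/and3P=> /eqP cX /eqP iX /eqP dX.
have [P [PH PA [S dP]]] := colspace_projector (A ^+ mindex A).
have [T dT] : exists T, X = A ^+ mindex A *m T.
  by apply: drazin_colspace; rewrite /is_drazin cX iX dX !eqxx.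
have PP : P *m P = P by rewrite {2}dP mulmxA PA -dP.
have AXP : A *m (X *m P) = P.
  by rewrite mulmxA cX dP mulmxA -(mulmxA X) -expmxS dX.
exists (X *m P); rewrite /is_core_ep; apply/and3P; split.
- by rewrite -!mulmxA AXP PP.
- apply/eq_colspaceP; split; first by exists (T *m P); rewrite mulmxA -dT.
  exists (A ^+ (mindex A).+1).
  by rewrite expmxSr -mulmxA (mulmxA P) PA -expmxSr dX.
- apply/eq_colspaceP; split.
    exists (ctrmx A *m A ^+ mindex A).
    by rewrite mulmxA -ctrmx_mul AXP PH PA.
  by exists (S *m ctrmx X); rewrite ctrmx_mul PH mulmxA -dP.
Qed.

Lemma core_ep_unique n (A X Y : 'M[C]_n) :
  is_core_ep A X -> is_core_ep A Y -> X = Y.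
Proof.
case/and3P=> /eqP iX /eq_colspaceP[[D1 dX] [D2 dA]].
case/eq_colspaceP=> [[D3 dA'] [D4 dX']].
case/and3P=> /eqP iY /eq_colspaceP[[E1 dY] [E2 dB]].
case/eq_colspaceP=> [[E3 dB'] [E4 dY']].
have XAY : X *m A *m Y = Y by rewrite dY dA !mulmxA iX.
have <- : X *m A *m Y = X.
  apply: (can_inj (@ctrmxK _ _)).
  have -> : X = ctrmx (E3 *m D4) *m Y.
    by apply: (can_inj (@ctrmxK _ _)); rewrite ctrmx_mul ctrmxK dX' dB' mulmxA.
  by rewrite -!mulmxA (mulmxA Y) iY.
by rewrite XAY.
Qed.

Definition core_ep n (A : 'M[C]_n) : 'M[C]_n := xchoose (core_ep_exists A).

Lemma core_epP n (A : 'M[C]_n) : is_core_ep A (core_ep A).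
Proof. exact: xchooseP. Qed.

Definition cepd n (A : 'M[C]_n) : Prop :=
  core_ep A *m drazin A = drazin A *m core_ep A.

End CoreEP.

(* Main.v *)
(* The index K of A (+) B bounds the indices of A and B, and the Drazin and core
   EP inverses are still characterized by the same equations when the index is
   replaced by any larger exponent.  At the common exponent K these equations
   hold blockwise, so both inverses of A (+) B are the direct sums of the
   inverses of A and B. *)
Require Import Defs.
From mathcomp Require Import all_boot all_order all_algebra.
From mathcomp Require Import reals complex.

Set Implicit Arguments.
Unset Strict Implicit.
Unset Printing Implicit Defensive.

Local Open Scope ring_scope.
Local Open Scope complex_scope.

Import GRing.Theory.

Lemma mul_diag_block_mx (S : pzSemiRingType) n1 n2 m1 m2 p1 p2
    (A : 'M[S]_(n1, m1)) (B : 'M_(n2, m2)) (D : 'M_(m1, p1)) (E : 'M_(m2, p2)) :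
  block_mx A 0 0 B *m block_mx D 0 0 E = block_mx (A *m D) 0 0 (B *m E).
Proof. by rewrite mulmx_block !mulmx0 !mul0mx !addr0 !add0r. Qed.

Section DiagBlockDrazin.
Variables (F : fieldType) (n m : nat).
Implicit Types (A : 'M[F]_n) (B : 'M[F]_m).

Lemma expr_diag_block_mx A B k :
  block_mx A 0 0 B ^+ k = block_mx (A ^+ k) 0 0 (B ^+ k).
Proof.
elim: k => [|k IHk]; first by rewrite !expr0 -scalar_mx_block.
by rewrite !expmxS IHk mul_diag_block_mx.
Qed.

(** The rank of a power of the direct sum is the sum of the ranks of the powers of [A] and [B].
    Neither summand can grow with the exponent, so once the sum is stationary both summands are. *)
Lemma mindex_diag_block_mx A B :
  (mindex A <= mindex (block_mx A 0 0 B))%N /\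
  (mindex B <= mindex (block_mx A 0 0 B))%N.
Proof.
have := mindexP (block_mx A 0 0 B); move: (mindex _) => k.
rewrite !expr_diag_block_mx !rank_diag_block_mx => eq_rk.
have leA : (\rank (A ^+ k.+1) <= \rank (A ^+ k))%N.
  by rewrite expmxS mxrankM_maxr.
have leB : (\rank (B ^+ k.+1) <= \rank (B ^+ k))%N.
  by rewrite expmxS mxrankM_maxr.
have eqA : \rank (A ^+ k) = \rank (A ^+ k.+1).
  apply/eqP; rewrite eqn_leq leA andbT.
  (* Adding the rank of [B ^+ k] to both sides and using [eq_rk] on the left reduces the goal to
     [leB]. *)
  by rewrite -(leq_add2r (\rank (B ^+ k))) eq_rk leq_add2l.
by split; apply: mindex_min => //; move: eq_rk; rewrite eqA => /addnI.
Qed.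

End DiagBlockDrazin.

(** Multiply the equation at exponent [mindex A] on the right by the remaining power of [A]. *)
Lemma is_drazin_exp (F : fieldType) n (A X : 'M[F]_n) k :
  is_drazin A X -> (mindex A <= k)%N -> X *m A ^+ k.+1 = A ^+ k.
Proof.
case/and3P=> _ _ /eqP dX le_k.
by rewrite -(subnKC le_k) -addSn !expmxD mulmxA dX.
Qed.

Lemma drazin_diag_block_mx (F : fieldType) n m (A : 'M[F]_n) (B : 'M[F]_m) :
  drazin (block_mx A 0 0 B) = block_mx (drazin A) 0 0 (drazin B).
Proof.
apply: drazin_unique (drazinP _) _.
have [leA leB] := mindex_diag_block_mx A B.
rewrite /is_drazin !expr_diag_block_mx !mul_diag_block_mx.
(* Only the third Drazin equation mentions the index; here it is needed at the index of the direct
   sum. *)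
rewrite (is_drazin_exp (drazinP A) leA) (is_drazin_exp (drazinP B) leB).
have /and3P[/eqP-> /eqP-> _] := drazinP A.
by have /and3P[/eqP-> /eqP-> _] := drazinP B; rewrite !eqxx.
Qed.

Section DiagBlockCoreEP.
Variable C : numClosedFieldType.

Lemma ctrmx_diag_block n1 n2 m1 m2 (A : 'M[C]_(n1, m1)) (B : 'M[C]_(n2, m2)) :
  ctrmx (block_mx A 0 0 B) = block_mx (ctrmx A) 0 0 (ctrmx B).
Proof. by rewrite /ctrmx tr_block_mx map_block_mx !trmx0 !map_mx0. Qed.

Lemma eq_colspace_sym n m p (M : 'M[C]_(n, m)) (N : 'M[C]_(n, p)) :
  eq_colspace M N = eq_colspace N M.
Proof. exact: andbC. Qed.

Lemma eq_colspace_trans n m p q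
    (M : 'M[C]_(n, m)) (N : 'M[C]_(n, p)) (P : 'M[C]_(n, q)) :
  eq_colspace M N -> eq_colspace N P -> eq_colspace M P.
Proof.
move=> /andP[MN NM] /andP[NP PN].
by apply/andP; split; apply: (@submx_trans _ _ _ _ _ _ N^T).
Qed.

(** Equal column spaces amount to right factorizations both ways, and the direct sum of the factors
    serves for the direct sum of the matrices. *)
Lemma eq_colspace_diag_block n1 n2 m1 m2 p1 p2
    (A : 'M[C]_(n1, m1)) (B : 'M[C]_(n2, m2))
    (D : 'M[C]_(n1, p1)) (E : 'M[C]_(n2, p2)) :
  eq_colspace A D -> eq_colspace B E ->
  eq_colspace (block_mx A 0 0 B) (block_mx D 0 0 E).
Proof.
move=> /eq_colspaceP[[S1 dA] [T1 dD]] /eq_colspaceP[[S2 dB] [T2 dE]].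
apply/eq_colspaceP; split.
  by exists (block_mx S1 0 0 S2); rewrite mul_diag_block_mx -dA -dB.
by exists (block_mx T1 0 0 T2); rewrite mul_diag_block_mx -dD -dE.
Qed.

(** Column spaces of powers stabilize at the index: [mindex_col] gives the nontrivial inclusion. *)
Lemma eq_colspace_mindex n (A : 'M[C]_n) k :
  (mindex A <= k)%N -> eq_colspace (A ^+ mindex A) (A ^+ k).
Proof.
move=> le_k; apply/eq_colspaceP; rewrite -(subnKC le_k).
by split; [apply: mindex_col | exists (A ^+ (k - mindex A)); apply: expmxD].
Qed.

Lemma is_core_ep_exp n (A X : 'M[C]_n) k :
  is_core_ep A X -> (mindex A <= k)%N ->
  eq_colspace X (A ^+ k) /\ eq_colspace (A ^+ k) (ctrmx X).
Proof.
case/and3P=> _ XA AX /eq_colspace_mindex Ak.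
split; first exact: eq_colspace_trans XA Ak.
by apply: eq_colspace_trans AX; rewrite eq_colspace_sym.
Qed.

Lemma core_ep_diag_block n m (A : 'M[C]_n) (B : 'M[C]_m) :
  core_ep (block_mx A 0 0 B) = block_mx (core_ep A) 0 0 (core_ep B).
Proof.
apply: core_ep_unique (core_epP _) _.
have [leA leB] := mindex_diag_block_mx A B.
have [XA AX] := is_core_ep_exp (core_epP A) leA.
have [XB BX] := is_core_ep_exp (core_epP B) leB.
have /and3P[/eqP iA _ _] := core_epP A; have /and3P[/eqP iB _ _] := core_epP B.
rewrite /is_core_ep expr_diag_block_mx !mul_diag_block_mx ctrmx_diag_block.
by rewrite iA iB eqxx !eq_colspace_diag_block.
Qed.

Lemma cepd_diag_block n m (A : 'M[C]_n) (B : 'M[C]_m) :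
  cepd (block_mx A 0 0 B) <-> cepd A /\ cepd B.
Proof.
(* Both products become block diagonal, so they agree exactly when their diagonal blocks do. *)
rewrite /cepd core_ep_diag_block drazin_diag_block_mx !mul_diag_block_mx.
by split=> [/eq_block_mx[]|[-> ->]].
Qed.

End DiagBlockCoreEP.

Theorem theorem3p4 (R : realType) (n m : nat) (A : 'M[R[i]]_n) (B : 'M[R[i]]_m) :
  cepd (block_mx A 0 0 B) <-> cepd A /\ cepd B.
Proof. exact: cepd_diag_block. Qed.
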